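(* Fix $d>0$ and consider the two-stage procedure described in the context, with first-stage sample size $N_0=N_0(\alpha)$, final sample size $\widehat N_{opt}=\widehat N_{opt}(\alpha)$, and asymptotically optimal sample size $N_{opt}^*=N_{opt}^*(\alpha)=\sigma_\mu^2\Phi^{-1}(1-\alpha/2)^2/d^2$. All limits are taken as $1-\alpha\to1$ with $d$ fixed. (i) Assume that the variance estimator is consistent and asymptotically unbiased, i.e. $\widehat\sigma_{N_0}^2/\sigma_\mu^2=1+o_P(1)$ and $E(\widehat\sigma_{N_0}^2)/\sigma_\mu^2=1+o(1)$. Then $\widehat N_{opt}$ is consistent for $N_{opt}^*$, i.e. $\widehat N_{opt}/N_{opt}^*=1+o_P(1)$ as $1-\alpha\to1$, and asymptotically first order efficient, i.e. $E(\widehat N_{opt})/N_{opt}^*=1+o(1)$ as $1-\alpha\to1$. (ii) If, in addition to the assumption in (i), $\widehat\mu_n$ satisfies the random central limit theorem, i.e. for every family $\{N_a:a>0\}$ of stopping times with $N_a/a\to k$ in probability as $a\to\infty$ for some $0<k<\infty$ it holds that $\sqrt{N_a}(\widehat\mu_{N_a}-\mu)/\sigma_\mu\to N(0,1)$ in distribution as $a\to\infty$, then the interval $I_{\widehat N_{opt}}=[\widehat\mu_{\widehat N_{opt}}-d,\ \widehat\mu_{\widehat N_{opt}}+d]$ has asymptotic coverage $1-\alpha$, i.e. $$\lim_{1-\alpha\to1}\big|P(I_{\widehat N_{opt}}\ni\mu)-(1-\alpha)\big|=0.$$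
   Context: $Y_1,Y_2,\dots$ are i.i.d. real random variables with mean $\mu$ and variance $\sigma^2\in(0,\infty)$. For each $n$, $\widehat\mu_n$ is an estimator of $\mu$ based on $Y_1,\dots,Y_n$ satisfying $\sqrt n(\widehat\mu_n-\mu)\to N(0,\sigma_\mu^2)$ in distribution for some constant $\sigma_\mu^2>0$, and $\widehat\sigma_n^2$ is an estimator of $\sigma_\mu^2$ based on $Y_1,\dots,Y_n$. $\Phi$ is the standard normal distribution function. $\widehat\sigma_{\mu,3}>0$ is a pilot estimate of $\sigma_\mu$ computed from three additional observations, on which one conditions throughout, so it is treated as a fixed positive constant. $\overline N_0\in\mathbb N$ is a given minimal sample size. For precision $d>0$ and confidence level $1-\alpha\in(0,1)$, the first-stage sample size is $$N_0=\max\Big\{\overline N_0,\ \Big\lfloor \frac{\Phi^{-1}(1-\alpha/2)\,\widehat\sigma_{\mu,3}}{d}\Big\rfloor+1\Big\}$$ and the final sample size is $$\widehat N_{opt}=\max\Big\{N_0,\ \Big\lfloor \frac{\widehat\sigma_{N_0}^2\,\Phi^{-1}(1-\alpha/2)^2}{d^2}\Big\rfloor+1\Big\}.$$ *)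

(* Defs.v *)
From HB Require Import structures.
From mathcomp Require Import all_boot all_order all_algebra finmap.
From mathcomp Require Import all_classical all_reals all_analysis.

Set Implicit Arguments.
Unset Strict Implicit.
Unset Printing Implicit Defensive.

Import Order.TTheory GRing.Theory Num.Theory.
Import numFieldNormedType.Exports.

Local Open Scope classical_set_scope.
Local Open Scope ring_scope.

Section modes_of_convergence.
Context {d : measure_display} {T : measurableType d} {R : realType}.
Variable P : probability T R.
Context {I : Type}.

Definition cvg_in_prob (F : set_system I) (X : I -> T -> R) (c : R) : Prop :=
  forall eps : R, 0 < eps ->
    P [set w | eps < `|X i w - c|] @[i --> F] --> (0 : \bar R)%E.

(* Convergence of the distribution functions at every continuity point of the
   limiting distribution function. *)
Definition cvg_in_dist (F : set_system I) (X : I -> T -> R)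
    (Q : probability (measurableTypeR R) R) : Prop :=
  forall x : R, {for x, continuous (fun y : R => Q [set` `]-oo, y]])} ->
    P [set w | X i w <= x] @[i --> F] --> Q [set` `]-oo, x]].

End modes_of_convergence.

(* The sequence Y_1, Y_2, ... is indexed from 0: Y_i is [Y i.-1]. *)
Section sample.
Context {d : measure_display} {T : measurableType d} {R : realType}.
Variables (P : probability T R) (Y : nat -> T -> R).

Definition mutually_independent : Prop :=
  forall (J : {fset nat}) (A : nat -> set R),
    (forall i, measurable (A i)) ->
    (P (\bigcap_(i in [set` J]) Y i @^-1` A i) =
     \prod_(i <- J) P (Y i @^-1` A i))%E.

Definition identically_distributed : Prop :=
  forall (i j : nat) (A : set R), measurable A ->
    P (Y i @^-1` A) = P (Y j @^-1` A).

Definition iid : Prop := mutually_independent /\ identically_distributed.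

Definition observations (n : nat) (w : T) : n.-tuple R :=
  [tuple Y i w | i < n].

Definition natural_filtration (n : nat) : set (set T) :=
  g_sigma_preimage (fun (i : 'I_n) (w : T) => Y i w).

Definition stopping_time (N : T -> nat) : Prop :=
  forall n : nat, natural_filtration n [set w | (N w <= n)%N].

End sample.

(* [est n] is the (Borel) function of the data whose value at the first n
   observations is the estimate. *)
Definition estimator (R : realType) : Type :=
  forall n : nat, {mfun n.-tuple R >-> R}.

Definition estimate {d : measure_display} {T : measurableType d} {R : realType}
    (est : estimator R) (Y : nat -> T -> R) (n : nat) (w : T) : R :=
  est n (observations Y n w).

Definition Phi {R : realType} (x : R) : R :=
  fine (normal_prob 0 1 [set` `]-oo, x]]).

Definition Phi_inv {R : realType} : R -> R := 'pinv_(fun=> 0) setT Phi.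

(* [Num.truncn x] is the floor of x when 0 <= x, which is the case for both
   uses below when 0 < alpha < 1, 0 < d, 0 < sigma3 and the variance estimator
   is nonnegative. *)
Section two_stage.
Context {R : realType}.
Variables (d sigma3 : R) (N0bar : nat).

Definition N0 (alpha : R) : nat :=
  maxn N0bar (Num.truncn (Phi_inv (1 - alpha / 2) * sigma3 / d)).+1.

Definition Nopt {disp : measure_display} {T : measurableType disp}
    (sig2hat : estimator R) (Y : nat -> T -> R) (alpha : R) (w : T) : nat :=
  maxn (N0 alpha)
    (Num.truncn (estimate sig2hat Y (N0 alpha) w *
                 Phi_inv (1 - alpha / 2) ^+ 2 / d ^+ 2)).+1.

Definition Nopt_star (sigma_mu alpha : R) : R :=
  sigma_mu ^+ 2 * Phi_inv (1 - alpha / 2) ^+ 2 / d ^+ 2.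

End two_stage.

Definition random_clt {d : measure_display} {T : measurableType d}
    {R : realType} (P : probability T R) (Y : nat -> T -> R)
    (muhat : estimator R) (mu sigma_mu : R) : Prop :=
  forall (N : R -> T -> nat) (k : R),
    (forall a, 0 < a -> stopping_time Y (N a)) ->
    0 < k ->
    cvg_in_prob P (pinfty_nbhs R) (fun a w => (N a w)%:R / a) k ->
    cvg_in_dist P (pinfty_nbhs R)
      (fun a w => Num.sqrt (N a w)%:R *
                  (estimate muhat Y (N a w) w - mu) / sigma_mu)
      (normal_prob 0 1).

(* Main.v *)
(* Write z = Phi^-1 (1 - alpha/2), s for the variance estimate divided by
   sigma_mu^2, and Nstar = sigma_mu^2 z^2 / d^2, which tends to infinity as
   alpha -> 0. Rounding and the minimal sample size N0 = O(z) contribute only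
   O(z) = o(Nstar) to the final sample size N, so that, surely,
     s <= N / Nstar <= s + O(1/z),
   which transfers consistency and asymptotic unbiasedness from s to N / Nstar.
   For the coverage, alpha is reparametrized by a = Nstar(alpha), whose inverse
   is alpha = 2 (1 - Phi (d sqrt a / sigma_mu)). In the scale a, N is a family
   of stopping times with N / a -> 1, so the random central limit theorem
   applies. The interval misses mu only if the studentized estimate exceeds
   d sqrt N / sigma_mu in absolute value; since N >= N0, this threshold is above
   a deterministic function of alpha tending to infinity. Hence the coverage
   probability tends to 1, as does 1 - alpha. *)
Require Import Defs.
From HB Require Import structures.
From mathcomp Require Import all_boot all_order all_algebra finmap.
From mathcomp Require Import all_classical all_reals all_analysis.
From mathcomp Require Import measurable_realfun zify ring lra.

Set Implicit Arguments.
Unset Strict Implicit.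
Unset Printing Implicit Defensive.

Import Order.TTheory GRing.Theory Num.Theory.
Import numFieldNormedType.Exports.

Local Open Scope classical_set_scope.
Local Open Scope ring_scope.

(** * The standard normal distribution function and its quantiles *)

Section normal_cdf.
Context {R : realType}.
Implicit Types x y p : R.

Lemma Phi_EFin x : (Phi x)%:E = normal_prob 0 1 [set` `]-oo, x]].
Proof. by rewrite fineK// fin_num_measure. Qed.

Lemma Phi_sub x y : x <= y ->
  (Phi y - Phi x)%:E = normal_prob 0 1 [set` `]x, y]].
Proof.
move=> xy; rewrite EFinB !Phi_EFin.
have -> : [set` `]x, y]] = [set` `]-oo, y]] `\` [set` `]-oo, x]] :> set R.
  apply/seteqP; split => t /=; rewrite !in_itv/=.
    by move=> /andP[xt ->]; split => //; apply/negP; rewrite -ltNge.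
  by move=> [-> /negP]; rewrite -ltNge => ->.
rewrite [RHS](@measureD _ _ _
  (normal_prob 0 1 : probability (measurableTypeR R) R))//=.
  congr (_ - normal_prob 0 1 _)%E; apply/seteqP; split => [t|t []//].
  by rewrite /= !in_itv/= => tx; split => //; exact: le_trans xy.
by rewrite ltey_eq fin_num_measure.
Qed.

(** The normal density is bounded by its peak. This Lipschitz bound gives the continuity of
    [Phi]. *)
Lemma Phi_sub_le x y : x <= y -> Phi y - Phi x <= normal_peak 1 * (y - x).
Proof.
move=> xy; rewrite -lee_fin Phi_sub// /normal_prob.
have -> : (normal_peak 1 * (y - x))%:E =
    (\int[lebesgue_measure]_(t in [set` `]x, y]]) (normal_peak 1)%:E)%E.
  rewrite integral_cst//= lebesgue_measure_itv/= lte_fin.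
  case: ltP => [//|yx].
  by rewrite mule0 (@le_anti _ _ x y) ?xy// subrr mulr0.
apply: ge0_le_integral => //=.
- by move=> t _; rewrite lee_fin normal_pdf_ge0.
- apply: measurable_funTS; apply/measurable_EFinP.
  exact: measurable_normal_pdf.
- by move=> t _; rewrite lee_fin normal_pdf_ub ?oner_neq0.
Qed.

(** The continuous, positive density attains a positive minimum on [[x, y]], and this minimum times
    the length bounds the increment from below. *)
Lemma Phi_lt x y : x < y -> Phi x < Phi y.
Proof.
move=> xy; rewrite -subr_gt0 -lte_fin (Phi_sub (ltW xy)).
have [c _ cmin] : exists2 c, c \in `[x, y] &
    forall t, t \in `[x, y] -> normal_pdf 0 1 c <= normal_pdf 0 1 t.
  apply: EVT_min; first exact: ltW.
  apply: continuous_subspaceT.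
  exact: (@continuous_normal_pdf R 0 1 (oner_neq0 R)).
have c_gt0 : 0 < normal_pdf 0 1 c.
  rewrite normal_pdfE ?oner_neq0//.
  by rewrite mulr_gt0 ?normal_peak_gt0 ?oner_neq0 ?expR_gt0.
apply: (@lt_le_trans _ _ (normal_pdf 0 1 c * (y - x))%:E).
  by rewrite lte_fin mulr_gt0 ?subr_gt0.
have -> : (normal_pdf 0 1 c * (y - x))%:E =
    (\int[lebesgue_measure]_(t in [set` `]x, y]]) (normal_pdf 0 1 c)%:E)%E.
  by rewrite integral_cst//= lebesgue_measure_itv/= lte_fin xy.
apply: ge0_le_integral => //=.
- by move=> t _; rewrite lee_fin ltW.
- apply: measurable_funTS; apply/measurable_EFinP.
  exact: measurable_normal_pdf.
- move=> t; rewrite in_itv/= => /andP[xt ty]; rewrite lee_fin.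
  by apply: cmin; rewrite in_itv/= ty ltW.
Qed.

Lemma Phi_le : {mono (@Phi R) : x y / x <= y}.
Proof. by apply: le_mono => x y; exact: Phi_lt. Qed.

Lemma Phi_inj : injective (@Phi R).
Proof. exact: mono_inj le_anti Phi_le. Qed.

Lemma Phi_continuous : continuous (@Phi R).
Proof.
move=> x; apply/cvgrPdist_le => e e0.
have k0 : 0 < normal_peak 1 :> R by rewrite normal_peak_gt0 ?oner_neq0.
have Lip y : `|Phi x - Phi y| <= normal_peak 1 * `|x - y|.
  case: (leP y x) => [yx|/ltW xy].
    by rewrite !ger0_norm ?subr_ge0 ?Phi_le// Phi_sub_le.
  by rewrite distrC (distrC x) !ger0_norm ?subr_ge0 ?Phi_le// Phi_sub_le.
near=> y; apply: le_trans (Lip y) _.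
rewrite mulrC -ler_pdivlMr//.
by near: y; apply: cvgr_dist_le => //; exact: divr_gt0.
Unshelve. all: by end_near. Qed.

(** As a random variable under the standard normal law, the identity has distribution function
    [Phi], so the general limits of [cdf] at both infinities apply. *)
Let idTR : measurableTypeR R -> R := idfun.

#[local] HB.instance Definition _ :=
  @isMeasurableFun.Build _ _ _ _ idTR (@measurable_id _ _ setT).

Lemma Phi_cvgy : Phi x @[x --> +oo] --> (1 : R).
Proof.
exact: fine_cvg (cvg_cdfy1 (idTR : {RV normal_prob 0 1 >-> R})).
Qed.

Lemma Phi_cvgNy : Phi x @[x --> -oo] --> (0 : R).
Proof.
exact: fine_cvg (cvg_cdfNy0 (idTR : {RV normal_prob 0 1 >-> R})).
Qed.

Lemma Phi_lt1 x : Phi x < 1.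
Proof.
apply: (@lt_le_trans _ _ (Phi (x + 1))); first by rewrite Phi_lt ?ltrDl.
by rewrite -lee_fin Phi_EFin probability_le1.
Qed.

Lemma Phi_inv_Phi x : Phi_inv (Phi x) = x.
Proof. by rewrite /Phi_inv pinvKV ?inE// => ? ? _ _; exact: Phi_inj. Qed.

(** The limits 0 and 1 at the infinities bracket [p] between two values of [Phi]; the intermediate
    value theorem then supplies a preimage. *)
Lemma Phi_invK p : 0 < p < 1 -> Phi (Phi_inv p) = p.
Proof.
move=> /andP[p0 p1].
suff [x xp] : exists x, Phi x = p by rewrite -xp Phi_inv_Phi.
have [a ap] : exists a, Phi a <= p.
  near (-oo : set_system R) => a; exists a; near: a.
  exact: (cvgr_le 0 Phi_cvgNy p p0).
have [b pb] : exists b, p <= Phi b.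
  near (+oo : set_system R) => b; exists b; near: b.
  exact: (cvgr_ge 1 Phi_cvgy p p1).
have ab : a <= b by rewrite -Phi_le (le_trans ap).
have [||x _ xp] := @IVT R (@Phi R) a b p ab; last by exists x.
  by apply: continuous_subspaceT; exact: Phi_continuous.
by rewrite (min_idPl _) ?Phi_le// (max_idPr _) ?Phi_le// ap.
Unshelve. all: by end_near. Qed.

Lemma Phi_inv_cvgy : Phi_inv (1 - a / 2) @[a --> (0 : R)^'+] --> +oo%R.
Proof.
apply/cvgryPge => M; near=> a.
have a0 : 0 < a by near: a; exact: nbhs_right_gt.
have a1 : a < 1 by near: a; exact: nbhs_right_lt.
rewrite -Phi_le Phi_invK; last by apply/andP; split; lra.
(* This bound on [a] is positive because [Phi M < 1], so it holds close enough to 0. *)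
suff : a <= 2 * (1 - Phi M) by lra.
near: a; apply: nbhs_right_le.
by rewrite mulr_gt0 ?subr_gt0 ?Phi_lt1.
Unshelve. all: by end_near. Qed.

End normal_cdf.

(** Eventually [c i] exceeds any fixed [M], so the probability is at least that of [- M < X i <= M],
    whose limit [Phi M - Phi (- M)] is close to 1 for large [M]. *)
Lemma cvg_in_dist_normal_le {disp : measure_display} {T : measurableType disp}
    {R : realType} (P : probability T R) (I : Type) (F : set_system I)
    {FF : Filter F} (X : I -> T -> R) (c : I -> R) :
  (forall i x, measurable [set w | X i w <= x]) ->
  (forall i (x : R), measurable [set w | `|X i w| <= x]) ->
  cvg_in_dist P F X (normal_prob 0 1) -> c i @[i --> F] --> +oo%R ->
  P [set w | `|X i w| <= c i] @[i --> F] --> 1%E.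
Proof.
move=> mX mabsX cvX cy.
(* Since [Phi] is continuous, every [x] is a continuity point. *)
have cvP x : fine (P [set w | X i w <= x]) @[i --> F] --> Phi x.
  apply: fine_cvg; rewrite Phi_EFin; apply: cvX.
  rewrite (_ : (fun y => _) = EFin \o @Phi R); last first.
    by apply/funext => y /=; rewrite Phi_EFin.
  apply: cvg_EFin; first exact: nearW.
  exact: Phi_continuous.
suff : fine (P [set w | `|X i w| <= c i]) @[i --> F] --> (1 : R).
  move=> H; apply/fine_cvgP; split => //.
  by apply: nearW => i; rewrite fin_num_measure.
apply/cvgrPdist_le => e e0.
(* One quarter for each tail of the limit law beyond [M], and one for each approximation of [Phi] at
   [M] and [- M]. *)
have e4 : 0 < e / 4 by rewrite divr_gt0.
have [M [MPhi MNPhi]] : exists M : R,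
    1 - e / 4 <= Phi M /\ Phi (- M) <= e / 4.
  near (+oo : set_system R) => M; exists M; split.
  - near: M; apply: (cvgr_ge 1 (@Phi_cvgy R)); lra.
  - near: M; apply: (cvgr_le 0) => //.
    by apply: cvg_comp (@Phi_cvgNy R); apply/cvgNrNy; exact: cvg_id.
near=> i.
have cM : M <= c i by near: i; move/cvgryPge : cy; exact.
have PM : Phi M - e / 4 <= fine (P [set w | X i w <= M]).
  by near: i; apply: (cvgr_ge _ (cvP M)); lra.
have PNM : fine (P [set w | X i w <= - M]) <= Phi (- M) + e / 4.
  by near: i; apply: (cvgr_le _ (cvP (- M))); lra.
have le1 : fine (P [set w | `|X i w| <= c i]) <= 1.
  by rewrite -lee_fin fineK ?fin_num_measure// probability_le1.
rewrite ger0_norm ?subr_ge0//.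
suff : fine (P [set w | X i w <= M]) - fine (P [set w | X i w <= - M]) <=
  fine (P [set w | `|X i w| <= c i]) by lra.
rewrite lerBlDl -lee_fin EFinD !fineK ?fin_num_measure//.
apply: le_trans (measureU2 _ _ _) => //.
apply: le_measure; rewrite ?inE//; first exact: measurableU.
move=> w /= XM; have [?|?] := leP (X i w) (- M); [by left|right].
by apply: le_trans cM; rewrite ler_norml XM ltW.
Unshelve. all: by end_near. Qed.

Lemma cvg_at_right0 {R : realType} (I : Type) (F : set_system I)
    {FF : Filter F} (f : I -> R) :
  (\forall i \near F, 0 < f i) -> f i @[i --> F] --> 0 ->
  f i @[i --> F] --> (0 : R)^'+.
Proof.
move=> f0 cvf A A0.
have fA : \forall i \near F, 0 < f i -> A (f i) by exact: (cvf _ A0).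
by apply: filterS2 f0 fA => i fi0; exact.
Qed.

(** * Measurability with respect to the observations, and random indices *)

Section filtration.
Context {disp : measure_display} {T : measurableType disp} {R : realType}.

(** Each [Y i] factors as a coordinate after [observations Y n], so the filtration consists of the
    preimages of measurable sets of tuples, and an estimate is a measurable function of the
    tuple. *)
Lemma natural_filtration_estimate (est : estimator R) (Y : nat -> T -> R)
    (n : nat) (B : set R) : measurable B ->
  natural_filtration Y n (estimate est Y n @^-1` B).
Proof.
move=> mB; rewrite /natural_filtration.
have -> : (fun i : 'I_n => Y i) =
    fun i : 'I_n => (@tnth n R)^~ i \o observations Y n.
  by apply/funext => i; apply/funext => w /=; rewrite tnth_mktuple.
rewrite g_sigma_preimage_comp; exists (est n @^-1` B); last by rewrite setTI.
exact: (measurable_funPTI (est n) mB).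
Qed.

Lemma natural_filtrationS (Y : nat -> T -> R) (m n : nat) : (m <= n)%N ->
  natural_filtration Y m `<=` natural_filtration Y n.
Proof.
move=> mn; apply: sub_sigma_algebra2 => A; rewrite -!bigcup_seq.
by move=> [i _ Ai]; exists (widen_ord mn i); rewrite /= ?mem_index_enum.
Qed.

Lemma natural_filtration_measurable (Y : nat -> {mfun T >-> R}) (n : nat) :
  natural_filtration (Y : nat -> T -> R) n `<=` measurable.
Proof.
rewrite /natural_filtration /g_sigma_preimage -bigcup_seq.
apply: smallest_sub; first exact: sigma_algebra_measurable.
move=> A [i _ [B mB <-]]; rewrite setTI.
exact: (measurable_funPTI (Y i) mB).
Qed.

(** The set splits into countably many pieces according to the value of [N]. *)
Lemma measurable_random_index (N : T -> nat) (A : nat -> set T) :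
  (forall n, measurable [set w | N w = n]) -> (forall n, measurable (A n)) ->
  measurable [set w | A (N w) w].
Proof.
move=> mN mA.
rewrite [X in measurable X](_ : _ = \bigcup_n ([set w | N w = n] `&` A n)).
  by apply: bigcup_measurable => n _; exact: measurableI.
by apply/seteqP; split => [w Aw|w [n _ [/= <-]]]//; exists (N w).
Qed.

Lemma stopping_time_measurable (Y : nat -> {mfun T >-> R}) (N : T -> nat)
    (n : nat) :
  stopping_time (Y : nat -> T -> R) N -> measurable [set w | N w = n].
Proof.
move=> sN; have mN k : measurable [set w | (N w <= k)%N].
  exact: natural_filtration_measurable (sN k).
case: n => [|n].
  rewrite (_ : [set w | _] = [set w | (N w <= 0)%N])//.
  by apply/seteqP; split => w /=; rewrite leqn0 => /eqP.
rewrite (_ : [set w | _] =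
    [set w | (N w <= n.+1)%N] `\` [set w | (N w <= n)%N]).
  exact: measurableD.
apply/seteqP; split => w /=; first by move=> ->; rewrite ltnn.
by move=> [Nn /negP]; rewrite -ltnNge => nN; apply/eqP; rewrite eqn_leq Nn.
Qed.

End filtration.

(** * Sure bounds on the final sample size *)

Section sample_size.
Context {R : realType}.
Variables (d sigma3 sigma_mu : R) (N0bar : nat).
Context {disp : measure_display} {T : measurableType disp}.
Variables (sig2hat : estimator R) (Y : nat -> T -> R).
Hypotheses (d_gt0 : 0 < d) (sigma3_gt0 : 0 < sigma3)
  (sigma_mu_gt0 : 0 < sigma_mu)
  (sig2hat_ge0 : forall n (x : n.-tuple R), 0 <= sig2hat n x).

Local Notation N0 := (N0 d sigma3 N0bar).
Local Notation Nstar := (Nopt_star d sigma_mu).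
Local Notation z alpha := (Phi_inv (1 - alpha / 2)).
Local Notation Nopt := (Nopt d sigma3 N0bar sig2hat Y).

(** The final size is a function of the first [N0 alpha] observations and is never below [N0 alpha]:
    the event is empty for smaller [n] and already decided at time [N0 alpha] for the others. *)
Lemma Nopt_stopping_time alpha : stopping_time Y (Nopt alpha).
Proof.
move=> n; rewrite /Nopt /Defs.Nopt.
have [nN0|N0n] := ltnP n (N0 alpha).
  rewrite [X in natural_filtration _ _ X](_ : _ = set0).
    exact: sigma_algebra0.
  by apply/seteqP; split => // w /=; rewrite geq_max leqNgt nN0.
set c := Phi_inv (1 - alpha / 2) ^+ 2 / d ^+ 2.
have c0 : 0 <= c by rewrite divr_ge0 ?sqr_ge0.
apply: (natural_filtrationS N0n).
(* For [s * c >= 0], the successor of the truncation of [s * c] is at most [n] exactly when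
   [s * c < n]; hence the open half-line. *)
rewrite [X in natural_filtration _ _ X](_ : _ =
    estimate sig2hat Y (N0 alpha) @^-1` ((fun s => s * c) @^-1` [set` `]-oo, n%:R[])).
  apply: natural_filtration_estimate.
  have mc : measurable_fun [set: R] (fun s : R => s * c).
    exact: measurable_funM.
  by rewrite -[X in measurable X]setTI; exact: mc.
by apply/seteqP; split => w /=;
  rewrite geq_max N0n in_itv/= -mulrA truncn_lt_nat// mulr_ge0 ?sig2hat_ge0.
Qed.

Lemma Nopt_star_cvgy : Nstar alpha @[alpha --> 0^'+] --> +oo.
Proof.
have k0 : 0 < (sigma_mu / d) ^+ 2 by rewrite exprn_gt0 ?divr_gt0.
(* Once [z alpha >= 1], its square dominates it, so a bound linear in [z alpha] suffices. *)
apply: ger_cvgy (gt0_cvgMry k0 (@Phi_inv_cvgy R)); near=> alpha.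
have z1 : 1 <= z alpha by near: alpha; move/cvgryPge : (@Phi_inv_cvgy R); exact.
have -> : Nstar alpha = (sigma_mu / d) ^+ 2 * z alpha ^+ 2.
  by rewrite /Nopt_star; field; rewrite gt_eqF.
by rewrite ler_pM2l// expr2 ler_peMr// (le_trans ler01).
Unshelve. all: by end_near. Qed.

(** The first stage alone forces this bound. It does not depend on [w] and provides the
    deterministic threshold for the coverage. *)
Lemma Nopt_gt alpha w : z alpha * sigma3 / d < (Nopt alpha w)%:R.
Proof.
apply: lt_le_trans (truncnS_gt _) _.
by rewrite ler_nat !leq_max leqnn orbT.
Qed.

Lemma Nopt_ratio_ge alpha w : 0 < z alpha ->
  estimate sig2hat Y (N0 alpha) w / sigma_mu ^+ 2 <=
  (Nopt alpha w)%:R / Nstar alpha.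
Proof.
move=> z0.
have Ns0 : 0 < Nstar alpha by rewrite !(divr_gt0, mulr_gt0, exprn_gt0).
rewrite ler_pdivlMr//.
have -> : estimate sig2hat Y (N0 alpha) w / sigma_mu ^+ 2 * Nstar alpha =
    estimate sig2hat Y (N0 alpha) w * z alpha ^+ 2 / d ^+ 2.
  by rewrite /Nopt_star; field; rewrite !gt_eqF.
apply: le_trans (ltW (truncnS_gt _)) _.
by rewrite ler_nat leq_max leqnn orbT.
Qed.

(** Bounding the maximum by a sum leaves, besides the main term, at most
    [N0bar + 2 + z * sigma3 / d]. For [z >= 1] this is at most [z * (N0bar + 2 + sigma3 / d)], and
    division by [Nstar] gives [C / z]. *)
Let C := (N0bar%:R + 2 + sigma3 / d) * d ^+ 2 / sigma_mu ^+ 2.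

Lemma Nopt_ratio_le alpha w : 1 <= z alpha ->
  (Nopt alpha w)%:R / Nstar alpha <=
  estimate sig2hat Y (N0 alpha) w / sigma_mu ^+ 2 + C / z alpha.
Proof.
move=> z1; have z0 : 0 < z alpha by exact: lt_le_trans z1.
have Ns0 : 0 < Nstar alpha by rewrite !(divr_gt0, mulr_gt0, exprn_gt0).
have s0 : 0 <= estimate sig2hat Y (N0 alpha) w by exact: sig2hat_ge0.
rewrite ler_pdivrMr//.
have -> : (estimate sig2hat Y (N0 alpha) w / sigma_mu ^+ 2 + C / z alpha) *
    Nstar alpha =
    estimate sig2hat Y (N0 alpha) w * z alpha ^+ 2 / d ^+ 2 +
    z alpha * (N0bar%:R + 2 + sigma3 / d).
  by rewrite /Nopt_star /C; field; rewrite !gt_eqF.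
set u := estimate _ _ _ _ * _ / _; set v := z alpha * sigma3 / d.
have u0 : 0 <= u := divr_ge0 (mulr_ge0 s0 (sqr_ge0 _)) (sqr_ge0 _).
have v0 : 0 <= v := divr_ge0 (mulr_ge0 (ltW z0) (ltW sigma3_gt0)) (ltW d_gt0).
have Nle : (Nopt alpha w)%:R <= u + 1 + (N0bar%:R + (v + 1)) :> R.
  apply: (@le_trans _ _ ((Num.truncn u).+1 + (N0bar + (Num.truncn v).+1))%:R).
    rewrite ler_nat /Nopt /Defs.Nopt /N0 -/u -/v !geq_max; lia.
  have := truncn_le u; have := truncn_le v; rewrite u0 v0 !natrD -2!natr1; lra.
apply: le_trans Nle _.
have -> : z alpha * (N0bar%:R + 2 + sigma3 / d) = z alpha * (N0bar%:R + 2) + v.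
  by rewrite /v; ring.
have : N0bar%:R + 2 <= z alpha * (N0bar%:R + 2) by rewrite ler_peMl ?addr_ge0.
lra.
Qed.

(** The error is uniform in [w], so the bounds can be used both inside probabilities and under
    expectations. *)
Lemma Nopt_ratio_squeeze : exists2 err : R -> R,
  err alpha @[alpha --> 0^'+] --> 0 &
  \forall alpha \near 0^'+, forall w,
    estimate sig2hat Y (N0 alpha) w / sigma_mu ^+ 2 <=
    (Nopt alpha w)%:R / Nstar alpha <=
    estimate sig2hat Y (N0 alpha) w / sigma_mu ^+ 2 + err alpha.
Proof.
have z1 : \forall alpha \near (0 : R)^'+, 1 <= z alpha.
  by move/cvgryPge : (@Phi_inv_cvgy R) => /(_ 1).
exists (fun alpha => C / z alpha).
  rewrite -[X in _ --> X](mulr0 C); apply: cvgM; first exact: cvg_cst.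
  apply/gtr0_cvgV0; last exact: Phi_inv_cvgy.
  by apply: filterS z1 => alpha; exact: lt_le_trans ltr01.
apply: filterS z1 => alpha z1 w.
by rewrite Nopt_ratio_ge ?Nopt_ratio_le// (lt_le_trans _ z1).
Qed.

End sample_size.

(** * Consistency, efficiency and coverage *)

Section two_stage_limits.
Context {disp : measure_display} {T : measurableType disp} {R : realType}.
Variables (P : probability T R) (Y : nat -> {RV P >-> R}).
Variables (mu sigma_mu d sigma3 : R) (N0bar : nat).
Variables (muhat sig2hat : estimator R).
Hypotheses (d_gt0 : 0 < d) (sigma3_gt0 : 0 < sigma3)
  (sigma_mu_gt0 : 0 < sigma_mu)
  (sig2hat_ge0 : forall n (x : n.-tuple R), 0 <= sig2hat n x).

Local Notation N0 := (N0 d sigma3 N0bar).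
Local Notation Nstar := (Nopt_star d sigma_mu).
Local Notation z alpha := (Phi_inv (1 - alpha / 2)).
Local Notation Nopt := (Nopt d sigma3 N0bar sig2hat Y).

Lemma measurable_estimate (est : estimator R) n :
  measurable_fun [set: T] (estimate est Y n).
Proof.
move=> _ B mB; rewrite setTI.
apply: (@natural_filtration_measurable _ _ _ Y n).
exact: natural_filtration_estimate.
Qed.

Lemma measurable_Nopt_eq alpha n : measurable [set w | Nopt alpha w = n].
Proof.
by apply: stopping_time_measurable; exact: Nopt_stopping_time.
Qed.

Lemma measurable_Nopt_estimate (f : nat -> R -> R) (est : estimator R) alpha :
  (forall n, measurable_fun [set: R] (f n)) ->
  measurable_fun [set: T]
    (fun w => f (Nopt alpha w) (estimate est Y (Nopt alpha w) w)).
Proof.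
move=> mf _ B mB; rewrite setTI.
apply: (measurable_random_index
  (A := fun n => [set w | B (f n (estimate est Y n w))])).
  exact: measurable_Nopt_eq.
move=> n; rewrite -[X in measurable X]setTI.
exact: (measurableT_comp (mf n) (measurable_estimate est n)).
Qed.

Lemma measurable_Nopt (f : nat -> R) alpha :
  measurable_fun [set: T] (fun w => f (Nopt alpha w)).
Proof.
exact: (@measurable_Nopt_estimate (fun n _ => f n) sig2hat).
Qed.

Lemma measurable_dist_gt (f : T -> R) (e c : R) : measurable_fun [set: T] f ->
  measurable [set w | e < `|f w - c|].
Proof.
move=> mf; have mg : measurable_fun [set: T] (fun w => `|f w - c|).
  by apply: measurableT_comp => //; exact: measurable_funB.
rewrite (_ : [set w | _] = (fun w => `|f w - c|) @^-1` [set` `]e, +oo[]).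
  by rewrite -[X in measurable X]setTI; exact: mg.
by apply/seteqP; split => w /=; rewrite in_itv/= andbT.
Qed.

(** Once the error is at most [e / 2], a deviation of the ratio beyond [e] forces one of the
    normalized variance estimate beyond [e / 2]. *)
Lemma Nopt_consistent :
  cvg_in_prob P 0^'+
    (fun alpha w => estimate sig2hat Y (N0 alpha) w / sigma_mu ^+ 2) 1 ->
  cvg_in_prob P 0^'+ (fun alpha w => (Nopt alpha w)%:R / Nstar alpha) 1.
Proof.
move=> cs e e0; have e2 : 0 < e / 2 by rewrite divr_gt0.
have [err err0 bnd] :=
  Nopt_ratio_squeeze N0bar Y d_gt0 sigma3_gt0 sigma_mu_gt0 sig2hat_ge0.
apply: (squeeze_cvge _ (cvg_cst 0%E) (cs _ e2)).
apply: filterS2 bnd (cvgr_le _ err0 _ e2) => alpha bnda erre2.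
rewrite measure_ge0/=.
apply: le_measure; rewrite ?inE.
- apply: (measurable_dist_gt (f := fun w => (Nopt alpha w)%:R / Nstar alpha)).
  exact: (measurable_Nopt (fun n => n%:R / Nstar alpha)).
- apply: (measurable_dist_gt
    (f := fun w => estimate sig2hat Y (N0 alpha) w / _)).
  by apply: measurable_funM => //; exact: measurable_estimate.
move=> w /=.
have /andP[] := bnda w.
move: (_ / Nstar alpha) (_ / sigma_mu ^+ 2) => a b ba aberr.
case: (ger0P (a - 1)) => ?; case: (ger0P (b - 1)) => ?; lra.
Qed.

(** Nonnegativity lets the normalization pass under the integral even when the expectation is
    infinite. *)
Lemma ge0_expectation_div (f : T -> R) (r : R) : measurable_fun [set: T] f ->
  (forall w, 0 <= f w) -> 0 < r ->
  ('E_P[f] / r%:E = \int[P]_w (f w / r)%:E)%E.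
Proof.
move=> mf f0 r0; rewrite unlock inver (gt_eqF r0).
under [RHS]eq_integral do rewrite EFinM.
rewrite ge0_integralZr//; first exact/measurable_EFinP.
- by move=> w _; rewrite lee_fin f0.
- by rewrite lee_fin invr_ge0 ltW.
Qed.

Lemma Nopt_efficient :
  ('E_P[estimate sig2hat Y (N0 alpha)] / (sigma_mu ^+ 2)%:E)%E
    @[alpha --> 0^'+] --> (1 : \bar R)%E ->
  ('E_P[fun w => (Nopt alpha w)%:R] / (Nstar alpha)%:E)%E
    @[alpha --> 0^'+] --> (1 : \bar R)%E.
Proof.
move=> ub.
have [err err0 bnd] :=
  Nopt_ratio_squeeze N0bar Y d_gt0 sigma3_gt0 sigma_mu_gt0 sig2hat_ge0.
have Ns0 : \forall alpha \near (0 : R)^'+, 0 < Nstar alpha.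
  have /cvgryPgt := Nopt_star_cvgy d_gt0 sigma_mu_gt0; exact.
(* The absolute value keeps the error nonnegative, as additivity of nonnegative integrals
   demands. *)
have ub' : ('E_P[estimate sig2hat Y (N0 alpha)] / (sigma_mu ^+ 2)%:E +
    `|err alpha|%:E)%E @[alpha --> 0^'+] --> (1 : \bar R)%E.
  rewrite -[X in _ --> X]adde0; apply: cvgeD => //.
  apply: cvg_EFin; first exact: nearW.
  by have := cvg_norm err0; rewrite normr0 => nerr; exact: nerr.
apply: (squeeze_cvge _ ub ub').
apply: filterS2 Ns0 bnd => alpha Na0 bnda.
have sm2 : 0 < sigma_mu ^+ 2 by rewrite exprn_gt0.
have s0 w : 0 <= estimate sig2hat Y (N0 alpha) w by exact: sig2hat_ge0.
have mN : measurable_fun [set: T] (fun w => (Nopt alpha w)%:R : R).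
  exact: (measurable_Nopt (fun n => n%:R)).
have ms := measurable_estimate sig2hat (N0 alpha).
rewrite !ge0_expectation_div//.
have mE (f : T -> R) r : measurable_fun [set: T] f ->
    measurable_fun [set: T] (fun w => (f w / r)%:E).
  by move=> mf; apply/measurable_EFinP; exact: measurable_funM.
have -> : (`|err alpha|%:E = \int[P]_w `|err alpha|%:E)%E.
  by rewrite integral_cst//= probability_setT mule1.
rewrite -ge0_integralD//;
  [|by move=> w _; exact: divr_ge0 (s0 w) (ltW sm2)|exact: mE].
apply/andP; split; apply: ge0_le_integral => //; try exact: mE.
- by move=> w _; exact: divr_ge0 (s0 w) (ltW sm2).
- by move=> w _; rewrite lee_fin; have /andP[] := bnda w.
- by move=> w _; exact: divr_ge0 (ler0n _ _) (ltW Na0).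
- by apply: emeasurable_funD => //; exact: mE.
- move=> w _; rewrite -EFinD lee_fin; have /andP[_ /le_trans->]// := bnda w.
  by rewrite lerD2l ler_norm.
Qed.

(** [random_clt] speaks of families indexed by their asymptotic size; this is the solution in
    [alpha] of [Nstar alpha = a]. *)
Let alpha_of a : R := 2 * (1 - Phi (d * Num.sqrt a / sigma_mu)).

Let Nopt_star_alpha_of a : 0 < a -> Nstar (alpha_of a) = a.
Proof.
move=> a0; rewrite /Nopt_star.
rewrite (_ : 1 - alpha_of a / 2 = Phi (d * Num.sqrt a / sigma_mu)).
  rewrite Phi_inv_Phi -[RHS](sqr_sqrtr (ltW a0)); field.
  by rewrite !gt_eqF.
by rewrite /alpha_of; field.
Qed.

Let alpha_of_Nopt_star alpha : 0 < alpha < 1 -> 0 <= z alpha ->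
  alpha_of (Nstar alpha) = alpha.
Proof.
move=> /andP[a0 a1] z0; rewrite /alpha_of.
have -> : Nstar alpha = (sigma_mu * z alpha / d) ^+ 2.
  by rewrite /Nopt_star; field; rewrite gt_eqF.
have szd0 : 0 <= sigma_mu * z alpha / d by rewrite divr_ge0 ?mulr_ge0// ltW.
(* Here [0 <= z alpha] makes the square root return the base itself. *)
rewrite sqrtr_sqr ger0_norm//.
have -> : d * (sigma_mu * z alpha / d) / sigma_mu = z alpha.
  by field; rewrite !gt_eqF.
rewrite Phi_invK; last by apply/andP; split; lra.
by field.
Qed.

Let alpha_of_cvg : alpha_of a @[a --> +oo] --> (0 : R)^'+.
Proof.
have sqrty : Num.sqrt a @[a --> +oo] --> (+oo : set_system R).
  apply/cvgryPge => A; near=> a.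
  apply: (le_trans (ler_norm A)); rewrite -sqrtr_sqr; apply: ler_wsqrtr.
  by near: a; apply: nbhs_pinfty_ge; rewrite num_real.
have lin a : d * Num.sqrt a / sigma_mu = d / sigma_mu * Num.sqrt a.
  by rewrite mulrAC.
rewrite /alpha_of; under eq_fun do rewrite lin.
(* The limit is approached from the right because [Phi < 1] everywhere. *)
apply: cvg_at_right0.
  by apply: nearW => a; rewrite mulr_gt0 ?subr_gt0 ?Phi_lt1.
rewrite -[X in _ --> X](mulr0 2); apply: cvgM; first exact: cvg_cst.
rewrite -[X in _ --> X](subrr 1); apply: cvgB; first exact: cvg_cst.
apply: cvg_comp (@Phi_cvgy R).
by apply: gt0_cvgMry sqrty; exact: divr_gt0.
Unshelve. all: by end_near. Qed.

Let student alpha w : R := Num.sqrt (Nopt alpha w)%:R *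
  (estimate muhat Y (Nopt alpha w) w - mu) / sigma_mu.

Lemma Nopt_clt :
  cvg_in_prob P 0^'+
    (fun alpha w => estimate sig2hat Y (N0 alpha) w / sigma_mu ^+ 2) 1 ->
  random_clt P Y muhat mu sigma_mu ->
  cvg_in_dist P 0^'+ student (normal_prob 0 1).
Proof.
move=> cs clt x cx.
have stop a : 0 < a -> stopping_time Y (Nopt (alpha_of a)).
  by move=> _; exact: Nopt_stopping_time.
have ratio : cvg_in_prob P (pinfty_nbhs R)
    (fun a w => (Nopt (alpha_of a) w)%:R / a) 1.
  move=> e e0; have := cvg_comp _ _ alpha_of_cvg (Nopt_consistent cs e0).
  apply: cvg_trans; apply: near_eq_cvg; near=> a => /=.
  by rewrite Nopt_star_alpha_of.
have H := clt _ 1 stop ltr01 ratio x cx.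
(* Substituting [a = Nstar alpha] pulls the limit back to [alpha]; the two families coincide for
   small [alpha]. *)
have := cvg_comp _ _ (Nopt_star_cvgy d_gt0 sigma_mu_gt0) H.
apply: cvg_trans; apply: near_eq_cvg; near=> alpha => /=.
rewrite alpha_of_Nopt_star//; last first.
  by near: alpha; move/cvgryPge : (@Phi_inv_cvgy R); exact.
apply/andP; split; near: alpha; [exact: nbhs_right_gt|exact: nbhs_right_lt].
Unshelve. all: by end_near. Qed.

Lemma Nopt_coverage_cvg1 :
  cvg_in_dist P 0^'+ student (normal_prob 0 1) ->
  P [set w | `|estimate muhat Y (Nopt alpha w) w - mu| <= d]
    @[alpha --> 0^'+] --> 1%E.
Proof.
move=> cX.
(* The value of [d * sqrt N / sigma_mu] when [N] is replaced by its lower bound in [Nopt_gt]. *)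
pose c alpha := d * Num.sqrt (z alpha * sigma3 / d) / sigma_mu.
have mst alpha : measurable_fun [set: T] (student alpha).
  apply: (measurable_Nopt_estimate
    (f := fun n x => Num.sqrt n%:R * (x - mu) / sigma_mu)).
  move=> n; apply: measurable_funM => //; apply: measurable_funM => //.
  exact: measurable_funB.
have mle (f : T -> R) x : measurable_fun [set: T] f ->
    measurable [set w | f w <= x].
  move=> mf; rewrite (_ : [set w | _] = f @^-1` [set` `]-oo, x]]).
    by rewrite -[X in measurable X]setTI; exact: mf.
  by apply/seteqP; split => w /=; rewrite in_itv.
have mabs alpha (x : R) : measurable [set w | `|student alpha w| <= x].
  by apply: (mle (fun w => `|student alpha w|)); exact: measurableT_comp.
have cy : c alpha @[alpha --> 0^'+] --> +oo.
  apply/cvgryPge => A; near=> alpha.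
  rewrite /c ler_pdivlMr// -ler_pdivrMl//.
  (* Passing to the absolute value, the square root of a square, reduces the goal to a lower bound
     on [z alpha] whatever the sign of [A]. *)
  apply: (le_trans (ler_norm _)); rewrite -sqrtr_sqr; apply: ler_wsqrtr.
  rewrite ler_pdivlMr// -ler_pdivrMr//.
  by near: alpha; move/cvgryPge : (@Phi_inv_cvgy R); exact.
have lb : P [set w | `|student alpha w| <= c alpha] @[alpha --> 0^'+] --> 1%E.
  by apply: cvg_in_dist_normal_le => // alpha x; exact: mle.
apply: (squeeze_cvge _ lb (cvg_cst 1%E)); apply: nearW => alpha.
have mA : measurable [set w | `|estimate muhat Y (Nopt alpha w) w - mu| <= d].
  apply: (mle (fun w => `|estimate muhat Y (Nopt alpha w) w - mu|)).
  apply: measurableT_comp => //.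
  apply: (measurable_Nopt_estimate (f := fun n x => x - mu)) => n.
  exact: measurable_funB.
rewrite probability_le1// andbT; apply: le_measure; rewrite ?inE// => w /=.
rewrite /student; set N : R := (Nopt alpha w)%:R => stc.
(* The successor in the definition of [Nopt] keeps [N] positive, so the factor [sqrt N] can be
   cancelled. *)
have sN0 : 0 < Num.sqrt N by rewrite sqrtr_gt0 ltr0n !leq_max ltn0Sn orbT.
move: stc.
rewrite !normrM normfV (ger0_norm (ltW sN0)) (gtr0_norm sigma_mu_gt0).
rewrite /c ler_pM2r ?invr_gt0// => stc.
rewrite -(ler_pM2l sN0); apply: le_trans stc _.
rewrite mulrC ler_pM2r//; apply: ler_wsqrtr.
exact/ltW/Nopt_gt.
Unshelve. all: by end_near. Qed.

End two_stage_limits.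

Theorem theorem2p3 (disp : measure_display) (T : measurableType disp)
    (R : realType) (P : probability T R) (Y : nat -> {RV P >-> R})
    (mu sigma : R) (muhat sig2hat : estimator R) (sigma_mu : R)
    (d sigma3 : R) (N0bar : nat)
    (Y_iid : iid P Y)
    (Y_L2 : forall i, (Y i : T -> R) \in Lfun P 2%:E)
    (Y_mean : forall i, ('E_P[Y i] = mu%:E)%E)
    (sigma_gt0 : 0 < sigma)
    (Y_var : forall i, ('V_P[Y i] = (sigma ^+ 2)%:E)%E)
    (sigma_mu_gt0 : 0 < sigma_mu)
    (muhat_clt : cvg_in_dist P \oo
       (fun n w => Num.sqrt n%:R * (estimate muhat Y n w - mu))
       (normal_prob 0 sigma_mu))
    (sig2hat_ge0 : forall n (x : n.-tuple R),
       0 <= sig2hat n x)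
    (d_gt0 : 0 < d) (sigma3_gt0 : 0 < sigma3)
    (sig2hat_consistent : cvg_in_prob P 0^'+
       (fun alpha w =>
          estimate sig2hat Y (N0 d sigma3 N0bar alpha) w / sigma_mu ^+ 2) 1)
    (sig2hat_unbiased :
       ('E_P[estimate sig2hat Y (N0 d sigma3 N0bar alpha)]
          / (sigma_mu ^+ 2)%:E)%E @[alpha --> 0^'+] --> (1 : \bar R)%E) :
  (cvg_in_prob P 0^'+
     (fun alpha w => (Nopt d sigma3 N0bar sig2hat Y alpha w)%:R /
                     Nopt_star d sigma_mu alpha) 1
   /\
   ('E_P[fun w => (Nopt d sigma3 N0bar sig2hat Y alpha w)%:R]
      / (Nopt_star d sigma_mu alpha)%:E)%E
     @[alpha --> 0^'+] --> (1 : \bar R)%E)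
  /\
  (random_clt P Y muhat mu sigma_mu ->
   `|P [set w |
         let m := estimate muhat Y (Nopt d sigma3 N0bar sig2hat Y alpha w) w in
         (mu \in `[m - d, m + d])%R]
     - (1 - alpha)%:E|%E @[alpha --> 0^'+] --> (0 : \bar R)%E).
Proof.
split; first by split; [exact: Nopt_consistent|exact: Nopt_efficient].
move=> clt.
have cov := Nopt_coverage_cvg1 d_gt0 sigma3_gt0 sigma_mu_gt0 sig2hat_ge0
  (Nopt_clt d_gt0 sigma3_gt0 sigma_mu_gt0 sig2hat_ge0 sig2hat_consistent clt).
have conf : (1 - alpha)%:E @[alpha --> (0 : R)^'+] --> 1%E.
  apply: cvg_EFin; first exact: nearW.
  rewrite -[X in _ --> X](subr0 1); apply: cvgB; first exact: cvg_cst.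
  by apply: cvg_at_right_filter; exact: cvg_id.
have coverE alpha : [set w |
    let m := estimate muhat Y (Nopt d sigma3 N0bar sig2hat Y alpha w) w in
    mu \in `[m - d, m + d]] =
    [set w |
    `|estimate muhat Y (Nopt d sigma3 N0bar sig2hat Y alpha w) w - mu| <= d].
  by apply/seteqP; split => w; rewrite /= in_itv/= ler_distlC.
under eq_fun do rewrite coverE.
(* Coverage and nominal level both tend to 1, so the limit is put in the form of their
   difference. *)
have -> : 0%E = `|1%E - 1%E|%E :> \bar R by rewrite subee// abse0.
by apply: cvg_abse; exact: cvgeB.
Qed.
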